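(* (1) Let $(\mathrm C_\bullet,b,B)$ be a mixed complex. If its Hochschild homology $\mathrm{HH}_\bullet=\mathrm H_\bullet(\mathrm C_\bullet,b)$ has a Batalin-Vilkovisky algebra structure such that $B$ is the generator of the Gerstenhaber bracket, then the following sequence of maps $$(\mathrm{HC}^-_\bullet)^{\otimes n}\to \mathrm{HC}^-_\bullet,\qquad (x_1,\dots,x_n)\mapsto(-1)^{(n-1)|x_1|+(n-2)|x_2|+\cdots+|x_{n-1}|}\,\beta\big(\pi_*(x_1)\cdot\pi_*(x_2)\cdot\cdots\cdot\pi_*(x_n)\big),\qquad n=2,3,\dots,$$ where $\cdot$ is the product on the Hochschild homology, give on the negative cyclic homology $\mathrm{HC}^-_\bullet$ a gravity algebra structure. (2) Suppose $f:(\mathrm C_\bullet,b,B)\to(\mathrm C'_\bullet,b',B')$ is a quasi-isomorphism of mixed complexes, and furthermore suppose that $(\mathrm{HH}_\bullet(\mathrm C),B)$ and $(\mathrm{HH}_\bullet(\mathrm C'),B')$ are extended to Batalin-Vilkovisky algebras such that $f_*$ is a Batalin-Vilkovisky algebra isomorphism. Then $\mathrm{HC}^-_\bullet(\mathrm C)$ and $\mathrm{HC}^-_\bullet(\mathrm C')$ are isomorphic as gravity algebras.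
   Context: The ground field $k$ has characteristic $0$ and contains $\mathbb R$; vector spaces are graded, and $|x|$ denotes the degree of a homogeneous element $x$. An upper grading and a lower grading are related by $V^i=V_{-i}$. Mixed complex: a graded vector space $\mathrm C_\bullet$ with operators $b$ of degree $-1$ and $B$ of degree $+1$ such that $b^2=B^2=bB+Bb=0$. Its Hochschild homology is $\mathrm{HH}_\bullet=\mathrm H_\bullet(\mathrm C_\bullet,b)$; the operator induced by $B$ on it is again denoted $B$. Let $u$ be a free variable of degree $-2$ commuting with $b$ and $B$. The negative cyclic homology $\mathrm{HC}^-_\bullet$ is the homology of $(\mathrm C_\bullet[\![u]\!],b+uB)$. A quasi-isomorphism of mixed complexes is a degree $0$ map commuting with the operators $b$ and $B$ and inducing an isomorphism on $b$-homology. The maps $\pi_*$ and $\beta$: the short exact sequence $0\to u\,\mathrm C_\bullet[\![u]\!]\to \mathrm C_\bullet[\![u]\!]\xrightarrow{\pi}\mathrm C_\bullet\to0$, with $\pi(\sum_i x_iu^i)=x_0$, together with the identification of the homology of $u\,\mathrm C_\bullet[\![u]\!]$ with $\mathrm{HC}^-_{\bullet+2}$, induces the long exact sequence $$\cdots\to\mathrm{HC}^-_{\bullet+2}\to\mathrm{HC}^-_\bullet\xrightarrow{\pi_*}\mathrm{HH}_\bullet\xrightarrow{\beta}\mathrm{HC}^-_{\bullet+1}\to\cdots.$$ Batalin-Vilkovisky algebra: a graded commutative algebra $(V,\cdot)$ with an operator $\Delta:V^i\to V^{i-1}$ such that $\Delta^2=0$ and, for all homogeneous $a,b,c\in V$,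 $$\begin{aligned}\Delta(abc)=&\ \Delta(ab)c+(-1)^{|a|}a\Delta(bc)+(-1)^{(|a|-1)|b|}b\Delta(ac)\\&-(\Delta a)bc-(-1)^{|a|}a(\Delta b)c-(-1)^{|a|+|b|}ab(\Delta c).\end{aligned}$$ The associated Gerstenhaber bracket, of which $\Delta$ is called the generator (or the Batalin-Vilkovisky operator), is $[a,b]=(-1)^{|a|+1}(\Delta(ab)-\Delta(a)b-(-1)^{|a|}a\Delta(b))$. Gravity algebra: a graded vector space $V$ with a sequence of graded skew-symmetric operators $\{x_1,\dots,x_n\}:V^{\otimes n}\to V$, $n=2,3,\dots$, where graded skew-symmetry means that exchanging two adjacent arguments $x,y$ multiplies the bracket by $-(-1)^{(|x|+1)(|y|+1)}$, such that $$\sum_{1\le i<j\le n}(-1)^{\epsilon_{ij}}\{\{x_i,x_j\},x_1,\dots,\hat x_i,\dots,\hat x_j,\dots,x_n,y_1,\dots,y_m\}=\begin{cases}\{\{x_1,\dots,x_n\},y_1,\dots,y_m\},&\text{if } m>0,\\0,&\text{otherwise},\end{cases}$$ where $\epsilon_{ij}=(|x_i|+1)(|x_1|+\cdots+|x_{i-1}|+i-1)+(|x_j|+1)(|x_1|+\cdots+|x_{j-1}|+j-1)-(|x_i|+1)(|x_j|+1)$. An isomorphism of gravity algebras is an isomorphism of graded vector spaces commuting with all the brackets.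
   Formalization: The gravity relation as displayed fails for these brackets (n=3, m=0 would force 2{{x,y},x}=0 for x, y of odd degree); here the sign (-1)^{ε_ij} is replaced by (-1)^{ε_ij+i+j+1} and the right-hand side is multiplied by (-1)^n. *)

(* Defs.v *)
From HB Require Import structures.
From mathcomp Require Import all_boot all_order all_algebra.
From mathcomp Require Import boolp reals zify.

Set Implicit Arguments.
Unset Strict Implicit.
Unset Printing Implicit Defensive.

Import Order.TTheory GRing.Theory Num.Theory.
Local Open Scope ring_scope.
Local Open Scope quotient_scope.

(** A graded vector space is a family [V : int -> lmodType k] in the LOWER
    grading.  The upper grading is V^i = V_{-i}; all signs below depend on
    degrees modulo 2 only, hence not on the choice of grading. *)

Section Homogeneous.
Variable k : fieldType.
Implicit Type V W : int -> lmodType k.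

Definition homog V := {i : int & V i}.

Definition hom V (i : int) (x : V i) : homog V := Tagged (fun i => V i) x.

(** Two homogeneous elements whose degrees are equal, but not convertibly so,
    are compared and added through their components: [component e x] is [x] itself
    if [x] has degree [e], and [0] otherwise. *)
Definition component V (e : int) (x : homog V) : V e := untag 0 (fun v : V e => v) x.

Definition hscale V (a : k) (x : homog V) : homog V := hom (a *: tagged x).

Definition hop V W (d : int -> int) (f : forall i, V i -> W (d i))
  (x : homog V) : homog W := hom (f (tag x) (tagged x)).

Definition sg (n : int) : k := (-1) ^ n.

End Homogeneous.

(** [cdiff i j] is the component C_i -> C_j of a differential of degree -1; it
    vanishes unless [j = i - 1]. *)
Record complex (k : fieldType) := Complex {
  cobj :> int -> lmodType k;
  cdiff : forall i j, {linear cobj i -> cobj j};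
  cdiff_deg : forall i j (x : cobj i), j != i - 1 -> cdiff i j x = 0;
  cdiff_sq : forall i j l (x : cobj i), cdiff j l (cdiff i j x) = 0 }.

Section LinearQuotient.
Variables (k : fieldType) (V : lmodType k) (S : zmodClosed V).
Hypothesis SZ : GRing.scaler_closed S.

Definition lquot of GRing.scaler_closed S := Quotient.quot S.
Local Notation Q := (lquot SZ).
HB.instance Definition _ := GRing.Zmodule.on Q.
HB.instance Definition _ := EqQuotient.on Q.
HB.instance Definition _ := isZmodQuotient.Build V (Quotient.equiv S)
  0 -%R +%R Q (@pi_zeror _ _ _ _ _ (Quotient.quot S))
  (@pi_oppr _ _ _ _ _ (Quotient.quot S)) (@pi_addr _ _ _ _ _ (Quotient.quot S)).

Lemma lquot_eqP (x y : V) :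
  reflect (\pi_Q x = \pi_Q y) ((x - y) \in S).
Proof. by rewrite Quotient.idealrBE; exact: eqP. Qed.

Definition lquot_scale (a : k) (q : Q) : Q := \pi_Q (a *: repr q).

Lemma lquot_scale_pi a x : lquot_scale a (\pi_Q x) = \pi_Q (a *: x).
Proof. by apply/lquot_eqP; rewrite -scalerBr SZ //; apply/lquot_eqP; rewrite reprK. Qed.

Fact lquot_scaleA a b q : lquot_scale a (lquot_scale b q) = lquot_scale (a * b) q.
Proof. by elim/quotW: q => x; rewrite !(lquot_scale_pi _ x) lquot_scale_pi scalerA. Qed.

Fact lquot_scale1 : left_id 1 lquot_scale.
Proof. by elim/quotW=> x; rewrite lquot_scale_pi scale1r. Qed.

Fact lquot_scaleDr : right_distributive lquot_scale +%R.
Proof.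
move=> a; elim/quotW=> x; elim/quotW=> y; rewrite -raddfD !lquot_scale_pi.
by rewrite -raddfD scalerDr.
Qed.

Fact lquot_scaleDl q : {morph lquot_scale^~ q : a b / a + b}.
Proof.
by elim/quotW: q => x a b; rewrite !lquot_scale_pi -raddfD scalerDl.
Qed.

HB.instance Definition _ := GRing.Zmodule_isLmodule.Build k Q
  lquot_scaleA lquot_scale1 lquot_scaleDr lquot_scaleDl.

End LinearQuotient.

Section Homology.
Variables (k : fieldType) (X : complex k) (i : int).

Definition is_cycle : {pred X i} := fun x => cdiff X i (i - 1) x == 0.

Fact is_cycle_closed : submod_closed is_cycle.
Proof.
split=> [|a x y]; rewrite !unfold_in ?linear0 // => /eqP x0 /eqP y0.
by rewrite linearP x0 y0 scaler0 addr0.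
Qed.
HB.instance Definition _ := GRing.isSubmodClosed.Build k (X i) is_cycle
  is_cycle_closed.

Record cycle := Cycle { cycle_val : X i; _ : cycle_val \in is_cycle }.
HB.instance Definition _ := [isSub for cycle_val].
HB.instance Definition _ := [Choice of cycle by <:].
HB.instance Definition _ := [SubChoice_isSubLmodule of cycle by <:].

Definition is_boundary : {pred cycle} :=
  fun z => `[< exists y : X (i + 1), \val z = cdiff X (i + 1) i y >].

Fact is_boundary_closed : submod_closed is_boundary.
Proof.
split=> [|a x y]; rewrite !unfold_in; first by apply/asboolP; exists 0; rewrite !linear0.
move=> /asboolP[u xu] /asboolP[v yv]; apply/asboolP; exists (a *: u + v).
by rewrite linearP -xu -yv.
Qed.
HB.instance Definition _ := GRing.isSubmodClosed.Build k cycle is_boundary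
  is_boundary_closed.

Definition homology_quot :=
  lquot (GRing.subsemimod_closedZ (GRing.submod_closed_semi is_boundary_closed)).

Definition homology : lmodType k := homology_quot.

Definition hclass (z : cycle) : homology := \pi_homology_quot z.

Definition hrepr (q : homology) : cycle := repr (q : homology_quot).

Lemma hreprK : cancel hrepr hclass.
Proof. by move=> q; exact: reprK. Qed.

Fact hclass_is_linear : linear hclass.
Proof.
move=> a x y; rewrite /hclass raddfD; congr (_ + _).
by symmetry; exact: lquot_scale_pi.
Qed.
HB.instance Definition _ := GRing.isLinear.Build k cycle homology *:%R hclass
  hclass_is_linear.

Lemma hclassP (z w : cycle) :
  reflect (hclass z = hclass w)
          `[< exists y : X (i + 1), \val z - \val w = cdiff X (i + 1) i y >].
Proof. exact: lquot_eqP. Qed.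

End Homology.

(** A linear map X_i -> Y_j which sends cycles to cycles and boundaries to
    boundaries, and the map H_i(X) -> H_j(Y) it induces.  It need not commute
    with the differentials strictly: B, for instance, anticommutes with b. *)
Section InducedMap.
Variables (k : fieldType) (X Y : complex k) (i j : int).

Record hcompat (g : X i -> Y j) : Prop := HCompat {
  hcompat_cycle : forall x, cdiff X i (i - 1) x = 0 ->
    cdiff Y j (j - 1) (g x) = 0;
  hcompat_boundary : forall y : X (i + 1), exists z : Y (j + 1),
    g (cdiff X (i + 1) i y) = cdiff Y (j + 1) j z }.

Variables (g : {linear X i -> Y j}) (gP : hcompat g).

Fact cycle_map_subproof (z : cycle X i) : g (\val z) \in @is_cycle k Y j.
Proof.
by apply/eqP/(hcompat_cycle gP)/eqP; exact: (valP z).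
Qed.

Definition cycle_map (z : cycle X i) : cycle Y j := Cycle (cycle_map_subproof z).

Definition hmap (q : homology X i) : homology Y j :=
  hclass (cycle_map (hrepr q)).

Lemma hmap_class (z : cycle X i) : hmap (hclass z) = hclass (cycle_map z).
Proof.
apply/hclassP/asboolP; rewrite /= -linearB.
have /hclassP/asboolP[y ->] := hreprK (hclass z).
exact: hcompat_boundary.
Qed.

Fact hmap_is_linear : linear hmap.
Proof.
move=> a p q; rewrite -[p]hreprK -[q]hreprK; set x := hrepr p; set y := hrepr q.
rewrite -linearP !hmap_class -linearP; congr hclass.
by apply: val_inj; rewrite /= linearP.
Qed.
HB.instance Definition _ := GRing.isLinear.Build k (homology X i)
  (homology Y j) *:%R hmap hmap_is_linear.

End InducedMap.

Record mixedComplex (k : fieldType) := MixedComplex {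
  mobj :> int -> lmodType k;
  mb : forall i j, {linear mobj i -> mobj j};
  mB : forall i j, {linear mobj i -> mobj j};
  mb_deg : forall i j (x : mobj i), j != i - 1 -> mb i j x = 0;
  mB_deg : forall i j (x : mobj i), j != i + 1 -> mB i j x = 0;
  mb_sq : forall i j l (x : mobj i), mb j l (mb i j x) = 0;
  mB_sq : forall i j l (x : mobj i), mB j l (mB i j x) = 0;
  mbB : forall i (x : mobj i),
    mb (i + 1) i (mB i (i + 1) x) + mB (i - 1) i (mb i (i - 1) x) = 0 }.

Section MixedTheory.
Variables (k : fieldType) (C : mixedComplex k).
Local Notation b := (mb C).
Local Notation B := (mB C).

Definition bcomplex : complex k := Complex (@mb_deg k C) (@mb_sq k C).

Definition HH (i : int) : lmodType k := homology bcomplex i.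

Lemma mbB' (i j j' l : int) (x : C i) : j = i + 1 -> j' = i - 1 -> l = i ->
  b j l (B i j x) + B j' l (b i j' x) = 0.
Proof. by move=> -> -> ->; exact: mbB. Qed.

Lemma mBb' (i j j' l : int) (x : C i) : j = i + 1 -> j' = i - 1 -> l = i ->
  B j' l (b i j' x) = - b j l (B i j x).
Proof. by move=> ej ej' el; apply/eqP; rewrite eq_sym eqr_oppLR -addr_eq0 mbB'. Qed.

Lemma bB0 i i' j : b i j 0 + B i' j 0 = 0.
Proof. by rewrite (linear0 (b i j)) (linear0 (B i' j)) addr0. Qed.

Fact mB_hcompat i : @hcompat k bcomplex bcomplex i (i + 1) (B i (i + 1)).
Proof.
split=> [x /= bx|y /=].
  have := @mbB' i (i + 1) (i - 1) (i + 1 - 1) x erefl erefl (addrK 1 i).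
  by rewrite bx linear0 addr0.
exists (- B (i + 1) (i + 1 + 1) y); rewrite linearN /=.
by apply: mBb'; lia.
Qed.

Definition HHB (i : int) : {linear HH i -> HH (i + 1)} := hmap (mB_hcompat i).

(** The homogeneous elements of degree [n] of C[[u]] are the series
    [x_0 + x_1 u + x_2 u^2 + ...] with [x_p] of degree [n + 2 p].  The degree
    [n + 2 p] is written [udeg n p], so that [udeg n 0] is [n] and
    [udeg n p.+1] is [udeg (n + 2) p] by conversion. *)
Fixpoint udeg (n : int) (p : nat) : int :=
  if p is q.+1 then udeg (n + 2) q else n.

Lemma udegE n p : udeg n p = n + (2 * p)%:Z.
Proof.
elim: p n => [|p IHp] n /=; first by rewrite muln0 addr0.
by rewrite IHp -addrA -PoszD mulnS.
Qed.

Definition useries (n : int) := forall p, C (udeg n p).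

Section USeries.
Variable n : int.

HB.instance Definition _ := gen_eqMixin (useries n).
HB.instance Definition _ := gen_choiceMixin (useries n).

Definition us0 : useries n := fun p => 0.
Definition usN (x : useries n) : useries n := fun p => - x p.
Definition usD (x y : useries n) : useries n := fun p => x p + y p.
Definition usZ (a : k) (x : useries n) : useries n := fun p => a *: x p.

Fact usDA : associative usD.
Proof. by move=> x y z; apply: functional_extensionality_dep => p; exact: addrA. Qed.
Fact usDC : commutative usD.
Proof. by move=> x y; apply: functional_extensionality_dep => p; exact: addrC. Qed.
Fact us0D : left_id us0 usD.
Proof. by move=> x; apply: functional_extensionality_dep => p; exact: add0r. Qed.
Fact usND : left_inverse us0 usN usD.
Proof. by move=> x; apply: functional_extensionality_dep => p; exact: addNr. Qed.
HB.instance Definition _ := GRing.isZmodule.Build (useries n) usDA usDC us0D usND.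

Fact usZA a c x : usZ a (usZ c x) = usZ (a * c) x.
Proof. by apply: functional_extensionality_dep => p; exact: scalerA. Qed.
Fact usZ1 : left_id 1 usZ.
Proof. by move=> x; apply: functional_extensionality_dep => p; exact: scale1r. Qed.
Fact usZDr : right_distributive usZ +%R.
Proof. by move=> a x y; apply: functional_extensionality_dep => p; exact: scalerDr. Qed.
Fact usZDl x : {morph usZ^~ x : a c / a + c}.
Proof. by move=> a c; apply: functional_extensionality_dep => p; exact: scalerDl. Qed.
HB.instance Definition _ := GRing.Zmodule_isLmodule.Build k (useries n)
  usZA usZ1 usZDr usZDl.

Lemma usP (x y : useries n) : (forall p, x p = y p) -> x = y.
Proof. exact: functional_extensionality_dep. Qed.

End USeries.

Definition udiff (i j : int) (x : useries i) : useries j := fun p =>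
  match p with
  | 0 => b i j (x 0%N)
  | q.+1 => b (udeg i q.+1) (udeg j q.+1) (x q.+1)
            + B (udeg i q) (udeg j q.+1) (x q)
  end.

Fact udiff_is_linear i j : linear (@udiff i j).
Proof.
move=> a x y; apply: usP => -[|p] /=; first exact: linearP.
rewrite [(_ + _ : useries i) p.+1]/(a *: x p.+1 + y p.+1).
rewrite [(_ + _ : useries i) p]/(a *: x p + y p).
rewrite [RHS]/(a *: (b (udeg i p.+1) (udeg j p.+1) (x p.+1)
  + B (udeg i p) (udeg j p.+1) (x p)) + (b (udeg i p.+1) (udeg j p.+1) (y p.+1)
  + B (udeg i p) (udeg j p.+1) (y p))).
by rewrite !linearP scalerDr addrACA.
Qed.
HB.instance Definition _ i j := GRing.isLinear.Build k (useries i) (useries j)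
  *:%R (@udiff i j) (@udiff_is_linear i j).

Fact udiff_deg i j (x : useries i) : j != i - 1 -> udiff j x = 0.
Proof.
move=> ji; apply: usP => -[|p]; first exact: mb_deg.
have bE : b (udeg i p.+1) (udeg j p.+1) (x p.+1) = 0.
  by apply: mb_deg; rewrite !udegE; apply: contra_neq ji; lia.
have BE : B (udeg i p) (udeg j p.+1) (x p) = 0.
  by apply: mB_deg; rewrite !udegE; apply: contra_neq ji; lia.
exact: (etrans (congr2 +%R bE BE) (addr0 0)).
Qed.

Fact udiff_sq i j l (x : useries i) : udiff l (udiff j x) = 0.
Proof.
have [ji|/(udiff_deg x) ->] := eqVneq j (i - 1); last by rewrite linear0.
have [lj|/(udiff_deg (udiff j x)) //] := eqVneq l (j - 1).
have mid p : b (udeg j p.+1) (udeg l p.+1) (B (udeg i p) (udeg j p.+1) (x p))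
    + B (udeg j p) (udeg l p.+1) (b (udeg i p) (udeg j p) (x p)) = 0.
  by apply: mbB'; rewrite !udegE; lia.
apply: usP => -[|[|p]]; first exact: mb_sq.
- rewrite [LHS]/(b _ (udeg l 1) (b _ _ (x 1%N) + B _ (udeg j 1) (x 0%N))
    + B (udeg j 0) (udeg l 1) (b (udeg i 0) (udeg j 0) (x 0%N))).
  by rewrite linearD mb_sq add0r; exact: (mid 0%N).
rewrite [LHS]/(b _ (udeg l p.+2) (b _ _ (x p.+2) + B _ (udeg j p.+2) (x p.+1))
  + B (udeg j p.+1) (udeg l p.+2) (b (udeg i p.+1) (udeg j p.+1) (x p.+1)
    + B _ _ (x p))).
by rewrite !linearD mb_sq mB_sq add0r addr0; exact: (mid p.+1).
Qed.

Definition ucomplex : complex k :=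
  @Complex k (fun n => useries n) (fun i j => @udiff i j) udiff_deg udiff_sq.

Definition HCm (i : int) : lmodType k := homology ucomplex i.

Definition upi (i : int) (x : useries i) : C i := x 0%N.

Fact upi_is_linear i : linear (@upi i). Proof. by []. Qed.
HB.instance Definition _ i := GRing.isLinear.Build k (useries i) (C i) *:%R
  (@upi i) (@upi_is_linear i).

Fact upi_hcompat i : @hcompat k ucomplex bcomplex i i (@upi i).
Proof.
split=> [x /= dx|y /=]; first by rewrite -[RHS]/((0 : useries (i - 1)) 0%N) -dx.
by exists (upi y).
Qed.

Definition pi_star (i : int) : {linear HCm i -> HH i} := hmap (upi_hcompat i).

(** Multiplication by [u], a bijection from the elements of degree [i + 2] of
    C[[u]] onto the elements of degree [i] of u C[[u]]. *)
Definition umul (i : int) (z : useries (i + 2)) : useries i := fun p =>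
  if p is q.+1 then z q else 0.

(** The inverse [x |-> u^-1 x] of [umul] on u C[[u]]; it is only used there. *)
Definition udiv (i : int) (x : useries i) : useries (i + 2) := fun p => x p.+1.

(** The section of [upi] given by constant series. *)
Definition uconst (i : int) (x : C i) : useries i := fun p =>
  if p is q.+1 then 0 else x.

(** Connecting homomorphism: lift to C[[u]], apply [b + u B], and divide the
    result, which lies in u C[[u]], by [u].  The resulting class has degree
    [i - 1 + 2 = i + 1]. *)
Definition beta_chain (i : int) (x : C i) : useries (i - 1 + 2) :=
  udiv (udiff (i - 1) (uconst x)).

Lemma beta_chainE i (x : C i) p :
  beta_chain x p = if p is q.+1 then 0 else B i (i - 1 + 2) x.
Proof.
case: p => [|p]; last exact: bB0.
by rewrite /beta_chain /udiv /= linear0 add0r.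
Qed.

Fact beta_chain_is_linear i : linear (@beta_chain i).
Proof.
move=> a x y; apply: usP => p.
rewrite [RHS]/(a *: beta_chain x p + beta_chain y p) !beta_chainE.
by case: p => [|p]; [exact: linearP | rewrite scaler0 [RHS]addr0].
Qed.
HB.instance Definition _ i := GRing.isLinear.Build k (C i) (useries (i - 1 + 2))
  *:%R (@beta_chain i) (@beta_chain_is_linear i).

Fact beta_chain_hcompat i :
  @hcompat k bcomplex ucomplex i (i - 1 + 2) (@beta_chain i).
Proof.
split=> [x /= bx|y /=].
  have bBx l : b (i - 1 + 2) l (B i (i - 1 + 2) x) = 0.
    have [->|ne] := eqVneq l i; last first.
      by rewrite mb_deg //; apply: contra ne => /eqP->; apply/eqP; lia.
    have := @mbB' i (i - 1 + 2) (i - 1) i x; rewrite bx linear0 addr0.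
    by apply=> //; lia.
  apply: usP => -[|[|p]] /=; rewrite !beta_chainE ?bBx //.
    by rewrite linear0 add0r mB_sq.
  exact: bB0.
exists (uconst (- B (i + 1) (i - 1 + 2 + 1) y)).
apply: usP => -[|[|p]]; rewrite beta_chainE /=.
- by rewrite linearN; apply: mBb'; lia.
- by rewrite linear0 add0r linearN mB_sq oppr0.
- by symmetry; exact: bB0.
Qed.

Definition beta (i : int) : {linear HH i -> HCm (i - 1 + 2)} :=
  hmap (beta_chain_hcompat i).

Lemma umul_beta_chain i (x : C i) : b i (i - 1) x = 0 ->
  umul (beta_chain x) = udiff (i - 1) (uconst x).
Proof. by move=> bx; apply: usP => -[|p] //=. Qed.

(** [beta] does not depend on the lift chosen above. *)
Lemma beta_connecting i (x : cycle bcomplex i) (xt : useries i)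
    (z : cycle ucomplex (i - 1 + 2)) :
  upi xt = \val x -> udiff (i - 1) xt = umul (\val z) ->
  beta i (hclass x) = hclass z.
Proof.
move=> xtx dxt; rewrite [LHS]hmap_class; apply/hclassP/asboolP => /=.
have e : i = i - 1 + 2 - 1 by lia.
have e2 : i - 1 + 2 + 1 = i + 2 by lia.
pose y : useries (i + 2) := fun p => - xt p.+1.
suff H (j : int) (ej : j = i + 2) : exists y : useries j,
    beta_chain (\val x) - \val z = udiff (i - 1 + 2) y by exact: H e2.
rewrite ej; exists y; apply: usP => p.
have zE : (\val z : useries _) p = udiff (i - 1) xt p.+1 by rewrite dxt.
rewrite [LHS]/(beta_chain (\val x) p - (\val z : useries _) p) zE beta_chainE.
rewrite -xtx; case: p {zE} => [|p].
  have subDr (U : zmodType) (v w : U) : w - (v + w) = - v.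
    by rewrite opprD addrC addrNK.
  exact: (etrans (subDr _ _ _) (esym (linearN (b (i + 2) (i - 1 + 2)) (xt 1%N)))).
rewrite [RHS]/(b (udeg i p.+2) (udeg (i - 1) p.+2) (- xt p.+2)
  + B (udeg i p.+1) (udeg (i - 1) p.+2) (- xt p.+1)).
have oppD (U : zmodType) (v w v' w' : U) :
    v' = - v -> w' = - w -> 0 - (v + w) = v' + w'.
  by move=> -> ->; rewrite sub0r opprD.
by apply: oppD; exact: linearN.
Qed.

End MixedTheory.

Record mixedMorphism (k : fieldType) (C C' : mixedComplex k) := MixedMorphism {
  mmap :> forall i, {linear C i -> C' i};
  mmap_b : forall i j (x : C i), mmap j (mb C i j x) = mb C' i j (mmap i x);
  mmap_B : forall i j (x : C i), mmap j (mB C i j x) = mB C' i j (mmap i x) }.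

Section QuasiIso.
Variables (k : fieldType) (C C' : mixedComplex k) (f : mixedMorphism C C').

Fact mmap_hcompat i : @hcompat k (bcomplex C) (bcomplex C') i i (f i).
Proof.
split=> [x /= bx|y /=]; first by rewrite -mmap_b bx linear0.
by exists (f (i + 1) y); rewrite mmap_b.
Qed.

Definition HHmap (i : int) : {linear HH C i -> HH C' i} := hmap (mmap_hcompat i).

Definition quasi_iso : Prop := forall i, bijective (HHmap i).

End QuasiIso.

Section BatalinVilkovisky.
Variable k : fieldType.

Definition gproduct (V : int -> lmodType k) :=
  forall i j, {bilinear V i -> V j -> V (i + j)%R}.

Definition hmul V (mul : gproduct V) (x y : homog V) : homog V :=
  hom (mul (tag x) (tag y) (tagged x) (tagged y)).

(** The operator V^i -> V^{i-1} raises the lower degree by 1. *)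
Definition goperator (V : int -> lmodType k) :=
  forall i, {linear V i -> V (i + 1)}.

Record is_BV V (mul : gproduct V) (Delta : goperator V) : Prop := IsBV {
  bv_mulA : forall x y z : homog V,
    hmul mul x (hmul mul y z) = hmul mul (hmul mul x y) z;
  bv_mulC : forall x y : homog V,
    hmul mul x y = hscale (sg k (tag x * tag y)) (hmul mul y x);
  bv_sq : forall i (x : V i), Delta (i + 1) (Delta i x) = 0;
  bv_seven : forall (x y z : homog V) (e : int),
    let m := hmul mul in
    let D := hop Delta in
    component e (D (m (m x y) z)) =
      component e (m (D (m x y)) z)
      + sg k (tag x) *: component e (m x (D (m y z)))
      + sg k ((tag x - 1) * tag y) *: component e (m y (D (m x z)))
      - component e (m (m (D x) y) z)
      - sg k (tag x) *: component e (m (m x (D y)) z)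
      - sg k (tag x + tag y) *: component e (m (m x y) (D z)) }.

Record BV_iso V V' (mul : gproduct V) (Delta : goperator V)
    (mul' : gproduct V') (Delta' : goperator V')
    (phi : forall i, {linear V i -> V' i}) : Prop := IsBVIso {
  bv_iso_bij : forall i, bijective (phi i);
  bv_iso_mul : forall i j (x : V i) (y : V j),
    phi (i + j) (mul i j x y) = mul' i j (phi i x) (phi j y);
  bv_iso_Delta : forall i (x : V i),
    phi (i + 1) (Delta i x) = Delta' i (phi i x) }.

End BatalinVilkovisky.

Section Gravity.
Variable k : fieldType.

(** The brackets [{x_1, ..., x_n}] of all arities, on homogeneous elements;
    only the values on sequences of length at least 2 are meaningful. *)
Definition brackets (V : int -> lmodType k) := seq (homog V) -> homog V.

Section Signs.
Variables (V : int -> lmodType k) (n : nat) (x : 'I_n -> homog V).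

(** With [i] counted from 0, [|x_1| + ... + |x_{i-1}| + i - 1] is the sum of
    [|x_l| + 1] over the predecessors [l] of [i]. *)
Definition shifted_before (i : 'I_n) : int := \sum_(l < n | (l < i)%N) (tag (x l) + 1).

Definition epsilon (i j : 'I_n) : int :=
  (tag (x i) + 1) * shifted_before i + (tag (x j) + 1) * shifted_before j
  - (tag (x i) + 1) * (tag (x j) + 1).

End Signs.

(** [epsilon] is the Koszul sign, for the degrees [|x| + 1], of moving [x_i] and
    [x_j] to the front.  Since the brackets are skew-symmetric for these
    degrees, the sign of that permutation, [(-1)^(i+j+1)], also enters, and the
    right-hand side carries [(-1)^n].  These are the signs obtained from the
    relations for graded symmetric brackets [s_n] of degree 1,
      sum_(i<j) +- s(s(x_i, x_j), x_1, ..., y_m) = s(s(x_1, ..., x_n), ..., y_m),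
    where [+-] is the Koszul sign for the degrees [|x|], by setting
      {x_1, ..., x_n} = (-1)^((n-1)|x_1| + ... + |x_(n-1)|) s_n(x_1, ..., x_n).
    Without them the relation for n = 3, m = 0 is not the graded Jacobi
    identity: on elements of odd degree, where the binary bracket is
    antisymmetric, it would say [{{x,x},y} + {{x,y},x} + {{x,y},x} = 0], that
    is, [{{x,y},x} = 0].

    The condition 2 < n + m excludes only the case n = 2, m = 0, in which the
    outer bracket would be unary. *)
Record is_gravity V (br : brackets V) : Prop := IsGravity {
  gravity_deg : forall s : seq (homog V), (1 < size s)%N ->
    tag (br s) = \sum_(x <- s) tag x + 1;
  gravity_linear : forall (s t : seq (homog V)) (i : int) (a : k) (x y : V i)
      (e : int), (0 < size s + size t)%N ->
    component e (br (s ++ hom (a *: x + y) :: t)) =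
      a *: component e (br (s ++ hom x :: t)) + component e (br (s ++ hom y :: t));
  gravity_skew : forall (s t : seq (homog V)) (x y : homog V) (e : int),
    component e (br (s ++ x :: y :: t)) =
      - (sg k ((tag x + 1) * (tag y + 1)) *: component e (br (s ++ y :: x :: t)));
  gravity_rel : forall (n : nat) (x : 'I_n -> homog V) (y : seq (homog V))
      (e : int), (1 < n)%N -> (2 < n + size y)%N ->
    \sum_(i < n) \sum_(j < n | (i < j)%N)
      sg k (epsilon x i j + (i + j + 1)%N%:Z) *:
        component e (br (br [:: x i; x j]
          :: [seq x l | l <- enum 'I_n & (l != i) && (l != j)] ++ y))
    = if (0 < size y)%N
      then sg k n%:Z *: component e (br (br [seq x l | l <- enum 'I_n] :: y))
      else 0 }.

Record gravity_iso V V' (br : brackets V) (br' : brackets V')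
    (phi : forall i, {linear V i -> V' i}) : Prop := IsGravityIso {
  gravity_iso_bij : forall i, bijective (phi i);
  gravity_iso_br : forall s : seq (homog V), (1 < size s)%N ->
    hop phi (br s) = br' [seq hop phi x | x <- s] }.

End Gravity.

Section NegativeCyclicBrackets.
Variables (k : fieldType) (C : mixedComplex k) (mul : gproduct (HH C)).

Fixpoint bracket_sign (s : seq (homog (HCm C))) : int :=
  if s is x :: t then (size t)%:Z * tag x + bracket_sign t else 0.

(** The value on the empty sequence is irrelevant. *)
Definition HCm_brackets : brackets (HCm C) := fun s =>
  if s is x :: t then
    hscale (sg k (bracket_sign s))
      (hop (beta C)
        (foldl (hmul mul) (hop (pi_star C) x) [seq hop (pi_star C) y | y <- t]))
  else hom (0 : HCm C 0).

End NegativeCyclicBrackets.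

(* Main.v *)
From HB Require Import structures.
From mathcomp Require Import all_boot all_order all_algebra.
From mathcomp Require Import boolp reals zify ring.
Require Import Defs.

(** Write a_l = pi_*(x_l).  The two facts about the long exact sequence behind
    the theorem are pi_* beta = B ([pi_beta]) and beta pi_* = 0 ([beta_pi]).
    They give B a_l = pi_* beta pi_* x_l = 0 ([pi_Delta_closed]) and
    beta B = beta pi_* beta = 0 ([beta_HHB]).

    The seven-term relation says that, for fixed [a] with Delta a = 0, the
    operator P |-> Delta(a P) - (-1)^|a| a Delta(P) obeys a Leibniz rule on
    Delta-closed factors ([Delta_lmul]).  Hence on a product of Delta-closed
    elements Delta acts as a second order operator without first order part
    ([Delta_hprod]):
      Delta(a_1 ... a_n) = sum_(i<j) +- Delta(a_i a_j) a_1 ... a_n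
    with a_i and a_j omitted from the last product and the Koszul sign for
    moving them to the front.  Since pi_* beta = B, a nested bracket
    {{x_1, ..., x_n}, y_1, ..., y_m} is, up to sign,
    beta(B(a_1 ... a_n) pi_*(y_1) ... pi_*(y_m)) ([bracket_bracket]), so the
    gravity relation is the image of that expansion under the linear map
    P |-> beta(P pi_*(y_1) ... pi_*(y_m)), and for m = 0 its right-hand side is
    beta B = 0 ([bracket_rel]).  The signs are compared in
    [gravity_sign].

    For the second part, a quasi-isomorphism [f] acts on power series
    coefficientwise and this action commutes with pi_* and beta, so it respects
    the brackets ([HCmap_brackets]).  It is bijective on negative cyclic homology
    because being a quasi-isomorphism amounts to acyclicity of the mapping cone
    ([cone_acyclic_bij], [bij_cone_acyclic]), and acyclicity passes from b to
    b + u B by solving for the coefficients of a power series one after the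
    other ([umap_cone_acyclic]). *)

Set Implicit Arguments.
Unset Strict Implicit.
Unset Printing Implicit Defensive.

Import GRing.Theory.
Local Open Scope ring_scope.

(** * Signs and components of homogeneous elements *)

Section Signs.
Variable k : fieldType.

Lemma sgD (m n : int) : sg k (m + n) = sg k m * sg k n.
Proof. by rewrite /sg expfzDr // oppr_eq0 oner_eq0. Qed.

(** All sign comparisons below are polynomial identities with an explicit
    multiple of 2, so that they can be left to [ring]. *)
Lemma sg_mod2 (m n q : int) : m = n + 2 * q -> sg k m = sg k n.
Proof.
move=> ->; rewrite sgD /sg [(-1) ^ (2 * q)](_ : _ = 1) ?mulr1 //.
rewrite -exprz_exp (_ : (-1) ^ 2 = 1) ?exp1rz //.
by rewrite -[2]/(Posz 2) -exprnP sqrrN expr1n.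
Qed.

End Signs.

Section Components.
Variable k : fieldType.
Implicit Type V W : int -> lmodType k.

Lemma component_hom V i (v : V i) : component i (hom v) = v.
Proof. by rewrite /component (untagE _ _ (erefl i : tag (hom v) = i)). Qed.

Lemma component0 V e (x : homog V) : tag x != e -> component e x = 0.
Proof. exact: untag_dflt. Qed.

Lemma component_hom0 V i e : component e (hom (0 : V i)) = 0.
Proof.
by have [<-|ie] := eqVneq i e; [exact: component_hom | exact: component0].
Qed.

Fact component_hom_is_linear V i e :
  linear (fun v : V i => component e (hom v)).
Proof.
have [<-|ie] := eqVneq i e => a x y; first by rewrite !component_hom.
by rewrite !component0 // scaler0 addr0.
Qed.

Lemma component_scale V e a (x : homog V) :
  component e (hscale a x) = a *: component e x.
Proof.
have [<-|xe] := eqVneq (tag x) e; last by rewrite !component0 // scaler0.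
by case: x => i x; rewrite !component_hom.
Qed.

(** A graded operator read at one degree of the source and one of the target.
    Sums of homogeneous elements only make sense componentwise, and this is the
    linear map through which an operator acts on such sums. *)
Definition hop_at V W (d : int -> int) (f : forall i, {linear V i -> W (d i)})
  e' e (v : V e') : W e := component e (hom (f e' v)).

Fact hop_at_is_linear V W d f e' e : linear (@hop_at V W d f e' e).
Proof.
by move=> a x y; rewrite /hop_at linearP component_hom_is_linear.
Qed.
HB.instance Definition _ V W d f e' e := GRing.isLinear.Build k (V e') (W e)
  *:%R (@hop_at V W d f e' e) (@hop_at_is_linear V W d f e' e).

Lemma component_hop V W d (f : forall i, {linear V i -> W (d i)}) e' e x :
  injective d -> d e' = e ->
  component e (hop f x) = hop_at f e (component e' x).
Proof.
move=> dI <-; have [xe|xe] := eqVneq (tag x) e'.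
  by case: e' / xe; case: x => i x /=; rewrite [component i _]component_hom.
by rewrite !component0 ?linear0 //=; apply: contra_neq xe => /dI.
Qed.

Lemma hop_scale V W d (f : forall i, {linear V i -> W (d i)}) a x :
  hop f (hscale a x) = hscale a (hop f x).
Proof. by rewrite /hop /hscale /= linearZ. Qed.

Lemma hscaleA V a c (x : homog V) : hscale a (hscale c x) = hscale (a * c) x.
Proof. by rewrite /hscale /= scalerA. Qed.

End Components.

(** * Products of homogeneous elements *)

Section Product.
Variables (k : fieldType) (V : int -> lmodType k) (mul : gproduct V).
Local Notation m := (hmul mul).
Implicit Types (a b c x y : homog V) (s t : seq (homog V)).

(** Multiplication by a fixed element as a graded operator, on either side:
    this gives access to [component_hop]. *)
Definition lmul a i : {linear V i -> V (tag a + i)} := mul (tag a) i (tagged a).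

Lemma hmul_lmul a x : m a x = hop (lmul a) x. Proof. by []. Qed.

Definition rmul a i : {linear V i -> V (i + tag a)} :=
  applyr (mul i (tag a)) (tagged a).

Lemma hmul_rmul a x : m x a = hop (rmul a) x. Proof. by []. Qed.

Lemma component_lmul a e x :
  component e (m a x) = hop_at (lmul a) e (component (e - tag a) x).
Proof. by rewrite hmul_lmul; apply: component_hop => [i j|]; lia. Qed.

Lemma component_rmul a e x :
  component e (m x a) = hop_at (rmul a) e (component (e - tag a) x).
Proof. by rewrite hmul_rmul; apply: component_hop => [i j|]; lia. Qed.

Lemma hmul_scalel u a x : m (hscale u a) x = hscale u (m a x).
Proof. by rewrite !hmul_rmul hop_scale. Qed.

Lemma hmul_scaler u a x : m a (hscale u x) = hscale u (m a x).
Proof. by rewrite !hmul_lmul hop_scale. Qed.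

(** The algebra need not have a unit, so a product has a first factor [a]. *)
Definition hprod a s := foldl m a s.

Lemma hprod_cat a s t : hprod a (s ++ t) = hprod (hprod a s) t.
Proof. exact: foldl_cat. Qed.

Lemma hprod_mul a b s : hprod a (b :: s) = hprod (m a b) s.
Proof. by []. Qed.

Lemma hprod_scale u a s : hprod (hscale u a) s = hscale u (hprod a s).
Proof. by elim: s a => //= b s IH a; rewrite hmul_scalel IH. Qed.

Lemma tag_hprod a s : tag (hprod a s) = tag a + \sum_(x <- s) tag x.
Proof.
by elim: s a => [|b s IH] a /=; rewrite ?big_nil ?addr0 // IH big_cons addrA.
Qed.

Hypothesis mA : forall x y z, m x (m y z) = m (m x y) z.
Hypothesis mC : forall x y, m x y = hscale (sg k (tag x * tag y)) (m y x).

Lemma hprod_cons a b s : hprod a (b :: s) = m a (hprod b s).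
Proof. by elim: s a b => //= c s IH a b; rewrite -[RHS]IH /= mA. Qed.

(** The new factor is placed second, right after [d], since in the expansion of
    Delta the factor Delta(a_i a_j) is to stay in front. *)
Lemma lmul_hprod b d t :
  m b (hprod d t) = hscale (sg k (tag b * tag d)) (hprod d (b :: t)).
Proof.
rewrite -[LHS]hprod_cons -hprod_scale.
by rewrite [hprod _ (b :: t)]/= hmul_scalel -mC.
Qed.

End Product.

(** * Families with one or two entries omitted *)

Section Omit.
Variable T : Type.

Definition tail n (x : 'I_n.+1 -> T) l := x (lift ord0 l).

Definition entries n (x : 'I_n -> T) := [seq x l | l <- enum 'I_n].

Definition omit1 n (x : 'I_n -> T) j := [seq x l | l <- enum 'I_n & l != j].

Definition omit2 n (x : 'I_n -> T) i j :=
  [seq x l | l <- enum 'I_n & (l != i) && (l != j)].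

Variables (n : nat) (x : 'I_n.+1 -> T).

Lemma entriesS : entries x = x ord0 :: entries (tail x).
Proof. by rewrite /entries enum_ordSl /= -map_comp. Qed.

Lemma omit10 : omit1 x ord0 = entries (tail x).
Proof.
rewrite /omit1 enum_ordSl /= filter_map -map_comp.
by rewrite (eq_filter (a2 := predT)) ?filter_predT.
Qed.

Lemma omit1S j : omit1 x (lift ord0 j) = x ord0 :: omit1 (tail x) j.
Proof. by rewrite /omit1 enum_ordSl /= filter_map -map_comp. Qed.

Lemma omit20S j : omit2 x ord0 (lift ord0 j) = omit1 (tail x) j.
Proof. by rewrite /omit2 /omit1 enum_ordSl /= filter_map -map_comp. Qed.

Lemma omit2SS i j :
  omit2 x (lift ord0 i) (lift ord0 j) = x ord0 :: omit2 (tail x) i j.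
Proof. by rewrite /omit2 enum_ordSl /= filter_map -map_comp. Qed.

Lemma sum_pairsS (M : nmodType) (F : 'I_n.+1 -> 'I_n.+1 -> M) :
  \sum_(i < n.+1) \sum_(j < n.+1 | (i < j)%N) F i j =
  \sum_(j < n) F ord0 (lift ord0 j)
  + \sum_(i < n) \sum_(j < n | (i < j)%N) F (lift ord0 i) (lift ord0 j).
Proof.
rewrite big_ord_recl; congr (_ + _).
  by rewrite big_mkcond big_ord_recl /= add0r.
apply: eq_bigr => i _; rewrite big_mkcond big_ord_recl /= add0r [RHS]big_mkcond.
by apply: eq_bigr => j _; rewrite /bump !add1n ltnS.
Qed.

End Omit.

Lemma size_omit1 (T : Type) n (x : 'I_n -> T) j : (size (omit1 x j)).+1 = n.
Proof.
elim: n x j => [x []//|n IH] x j; case: (unliftP ord0 j) => [l|] ->.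
  by rewrite omit1S /= IH.
by rewrite omit10 size_map size_enum_ord.
Qed.

Lemma size_omit2 (T : Type) n (x : 'I_n -> T) (i j : 'I_n) :
  (i < j)%N -> (size (omit2 x i j)).+2 = n.
Proof.
elim: n x i j => [x []//|n IH] x i j.
case: (unliftP ord0 j) => [j'|] -> //.
case: (unliftP ord0 i) => [i'|] -> ij; first by rewrite omit2SS /= IH.
by rewrite omit20S size_omit1.
Qed.

Section DegreeBefore.
Variables (k : fieldType) (V : int -> lmodType k).

(** [tag (x i) * before x i] is the exponent of the Koszul sign for moving [x i]
    to the front. *)
Definition before n (x : 'I_n -> homog V) (i : 'I_n) : int :=
  \sum_(l < n | (l < i)%N) tag (x l).

Lemma before0 n (x : 'I_n.+1 -> homog V) : before x ord0 = 0.
Proof. by rewrite /before big_pred0. Qed.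

Lemma beforeS n (x : 'I_n.+1 -> homog V) i :
  before x (lift ord0 i) = tag (x ord0) + before (tail x) i.
Proof.
rewrite /before big_mkcond big_ord_recl /=; congr (_ + _).
by rewrite [RHS]big_mkcond; apply: eq_bigr => l _; rewrite /bump !add1n ltnS.
Qed.

End DegreeBefore.

(** * Delta on a product of Delta-closed elements *)

Section BVExpansion.
Variables (k : fieldType) (V : int -> lmodType k) (mul : gproduct V).
Variable Delta : goperator V.
Hypothesis BV : is_BV mul Delta.
Local Notation m := (hmul mul).
Local Notation D := (hop Delta).
Local Notation hprod := (hprod mul).
Local Notation sg := (sg k).

Definition Delta_closed (a : homog V) := forall e, component e (D a) = 0.

Let mA := bv_mulA BV.
Let mC := bv_mulC BV.

(** Leibniz rule for P |-> Delta(a P) - (-1)^|a| a Delta(P).  For P = b Q with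
    a and b closed the seven-term relation reads
      Delta(a b Q) - (-1)^|a| a Delta(b Q) = Delta(a b) Q
        + (-1)^((|a|-1)|b|) b (Delta(a Q) - (-1)^|a| a Delta(Q)),
    so that the formula follows by induction on the number of factors. *)
Lemma Delta_lmul a n (x : 'I_n.+1 -> homog V) e :
  Delta_closed a -> (forall i, Delta_closed (x i)) ->
  component e (D (m a (hprod (x ord0) (entries (tail x))))) =
  sg (tag a) *: component e (m a (D (hprod (x ord0) (entries (tail x)))))
  + \sum_j sg (tag (x j) * before x j) *:
      component e (hprod (D (m a (x j))) (omit1 x j)).
Proof.
move=> aK; elim: n x e => [|n IH] x e xK.
  rewrite {1 2}/entries enum_ord0 /= big_ord1 omit10 before0 mulr0 scale1r.
  rewrite {1}/entries enum_ord0 /=.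
  by rewrite component_lmul xK linear0 scaler0 add0r.
rewrite entriesS (hprod_cons mA) big_ord_recl omit10 before0 mulr0 scale1r.
rewrite entriesS (hprod_cons mA) mA.
set b := x ord0; set z := hprod _ _.
have -> := bv_seven BV a b z e.
have Da0 : component e (m (m (D a) b) z) = 0.
  by rewrite !component_rmul aK !linear0.
have Db0 : component e (m (m a (D b)) z) = 0.
  by rewrite component_rmul component_lmul xK !linear0.
have zE : z = hprod (tail x ord0) (entries (tail (tail x))) by [].
(* b times the induction hypothesis: [b] is moved past [a] in the first term
   and past Delta(a x_j) in the others. *)
have bDa : component e (m b (D (m a z))) =
    sg (tag a + tag a * tag b) *: component e (m a (m b (D z)))
    + \sum_(j < n.+1) sg (tag (tail x j) * before (tail x) j
                          + tag b * (tag a + tag (tail x j) + 1))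
      *: component e (hprod (D (m a (tail x j))) (b :: omit1 (tail x) j)).
  rewrite component_lmul zE IH; last by move=> i; exact: xK.
  rewrite linearD linearZ linear_sum /= -component_lmul; congr (_ + _).
    rewrite !mA (mC b) hmul_scalel component_scale scalerA -sgD.
    by rewrite (mulrC (tag b)).
  apply: eq_bigr => j _; rewrite linearZ /= -component_lmul.
  by rewrite (lmul_hprod mA mC) component_scale scalerA -sgD.
rewrite bDa Da0 Db0 scaler0 !subr0 -mA addrAC -!addrA addrCA.
congr (_ + (_ + _)).
rewrite scalerDr scalerA -sgD.
(* The term -(-1)^(|a|+|b|) a b Delta(z) cancels the first term of [bDa]. *)
rewrite (@sg_mod2 k _ (tag a + tag b) (tag b * (tag a - 1))); last by ring.
rewrite addKr scaler_sumr; apply: eq_bigr => j _.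
rewrite omit1S beforeS scalerA -sgD; congr (_ *: _).
apply: (@sg_mod2 k _ _ (tag b * tag a)); rewrite /tail; ring.
Qed.

(** Split off the first factor: by [Delta_lmul] it produces the pairs (0, j), and
    (-1)^|a| a Delta(P) produces, by induction, the pairs among the remaining
    factors. *)
Lemma Delta_hprod n (x : 'I_n.+1 -> homog V) e :
  (forall i, Delta_closed (x i)) ->
  component e (D (hprod (x ord0) (entries (tail x)))) =
  \sum_(i < n.+1) \sum_(j < n.+1 | (i < j)%N)
    sg (tag (x i) * before x i + tag (x j) * before x j
        - tag (x i) * tag (x j))
      *: component e (hprod (D (m (x i) (x j))) (omit2 x i j)).
Proof.
elim: n x e => [|n IH] x e xK.
  rewrite /entries enum_ord0 /= xK big_ord1 big1 // => j.
  by rewrite (ord1 j).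
rewrite entriesS (hprod_cons mA) Delta_lmul //; last by move=> i; exact: xK.
rewrite [RHS]sum_pairsS addrC.
congr (_ + _); last first.
  rewrite component_lmul IH; last by move=> i; exact: xK.
  rewrite linear_sum scaler_sumr; apply: eq_bigr => i _.
  rewrite linear_sum scaler_sumr; apply: eq_bigr => j _.
  rewrite linearZ /= -component_lmul (lmul_hprod mA mC) component_scale omit2SS.
  rewrite !beforeS !scalerA -!sgD; congr (_ *: _).
  apply: (@sg_mod2 k _ _ (tag (x ord0))); rewrite /tail /=; ring.
apply: eq_bigr => j _; rewrite omit20S before0 beforeS.
by congr (sg _ *: _); rewrite /tail; ring.
Qed.

End BVExpansion.

(** * The signs of the gravity relation *)

Section ShiftedDegrees.
Variables (k : fieldType) (V : int -> lmodType k).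

Lemma shifted_beforeE n (x : 'I_n -> homog V) i :
  shifted_before x i = before x i + i%:Z.
Proof.
elim: n x i => [x []//|n IH] x i; case: (unliftP ord0 i) => [j|] ->; last first.
  by rewrite /shifted_before before0 big_pred0.
have -> : shifted_before x (lift ord0 j)
    = tag (x ord0) + 1 + shifted_before (tail x) j.
  rewrite /shifted_before big_mkcond big_ord_recl /=; congr (_ + _).
  by rewrite [RHS]big_mkcond; apply: eq_bigr => l _; rewrite /bump !add1n ltnS.
by rewrite beforeS IH /= /bump; lia.
Qed.

End ShiftedDegrees.

(** Two complexes occur because this also compares the signs on the two sides
    of a map of gravity algebras. *)
Lemma bracket_sign_eq (k : fieldType) (C C' : mixedComplex k)
    (s : seq (homog (HCm C))) (s' : seq (homog (HCm C'))) :
  map (@tag _ _) s = map (@tag _ _) s' -> bracket_sign s = bracket_sign s'.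
Proof.
elim: s s' => [|x s IH] [|y s'] //= [-> /[dup] e /IH ->].
by have /(congr1 size) := e; rewrite !size_map => ->.
Qed.

Section BracketSign.
Variables (k : fieldType) (C : mixedComplex k).
Local Notation H := (HCm C).
Local Notation bs := (@bracket_sign k C).

Definition degree (s : seq (homog H)) : int := \sum_(x <- s) tag x.

Lemma degree_cons x s : degree (x :: s) = tag x + degree s.
Proof. exact: big_cons. Qed.

Lemma degree_omit1 n (x : 'I_n -> homog H) j :
  tag (x j) + degree (omit1 x j) = degree (entries x).
Proof.
elim: n x j => [x []//|n IH] x j; rewrite entriesS degree_cons.
case: (unliftP ord0 j) => [l|] ->; last by rewrite omit10.
by rewrite omit1S degree_cons addrCA IH.
Qed.

Lemma degree_omit2 n (x : 'I_n -> homog H) (i j : 'I_n) : (i < j)%N ->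
  tag (x i) + tag (x j) + degree (omit2 x i j) = degree (entries x).
Proof.
elim: n x i j => [x []//|n IH] x i j; rewrite entriesS degree_cons.
case: (unliftP ord0 j) => [j'|] -> //.
case: (unliftP ord0 i) => [i'|] -> ij.
  by rewrite omit2SS degree_cons addrCA -(IH _ _ _ ij).
by rewrite omit20S -addrA degree_omit1.
Qed.

Lemma bracket_sign_cat s t :
  bs (s ++ t) = bs s + (size t)%:Z * degree s + bs t.
Proof.
elim: s => [|x s IH] /=; first by rewrite /degree big_nil mulr0 !add0r.
rewrite degree_cons IH size_cat PoszD; ring.
Qed.

Lemma bracket_sign_omit1 n (x : 'I_n -> homog H) j :
  bs (omit1 x j) + tag (x j) * (n%:Z - 1 - j%:Z) + before x j = bs (entries x).
Proof.
elim: n x j => [x []//|n IH] x j; rewrite entriesS /=.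
rewrite size_map size_enum_ord.
case: (unliftP ord0 j) => [l|] ->; last by rewrite omit10 before0 /=; ring.
have sE : (size (omit1 (tail x) l))%:Z = n%:Z - 1.
  by rewrite -[n in RHS](size_omit1 (tail x) l); lia.
rewrite omit1S beforeS /= sE -(IH _ l) /bump /tail /= add1n !intS.
ring.
Qed.

(** Each entry is weighted by the number of entries after it, so omitting x_i and
    x_j lowers the other weights by [before x i + before x j] in total, except
    that x_i, which is counted in [before x j], is omitted as well. *)
Lemma bracket_sign_omit2 n (x : 'I_n -> homog H) (i j : 'I_n) : (i < j)%N ->
  bs (omit2 x i j) + tag (x i) * (n%:Z - 1 - i%:Z)
    + tag (x j) * (n%:Z - 1 - j%:Z) + before x i + before x j - tag (x i)
  = bs (entries x).
Proof.
elim: n x i j => [x []//|n IH] x i j; rewrite entriesS /=.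
rewrite size_map size_enum_ord.
case: (unliftP ord0 j) => [j'|] -> //.
case: (unliftP ord0 i) => [i'|] -> ij.
  have sE : (size (omit2 (tail x) i' j'))%:Z = n%:Z - 2.
    by rewrite -[n in RHS](size_omit2 (tail x) ij); lia.
  rewrite omit2SS !beforeS /= sE -(IH _ _ _ ij) /bump /tail /= !add1n !intS.
  ring.
rewrite omit20S before0 beforeS -(bracket_sign_omit1 _ j') /bump /tail /=.
rewrite !intS; ring.
Qed.

(** On the left, the sign in the gravity relation times the signs of the nested
    bracket {{x_i, x_j}, ...}, where [z] stands for {x_i, x_j}; on the right, a
    sign independent of i and j times the Koszul sign of [Delta_hprod].  The
    first factor on the right is (-1)^n times the signs of the nested bracket
    {{x_1, ..., x_n}, y_1, ..., y_m}. *)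
Lemma gravity_sign n (x : 'I_n -> homog H) (y : seq (homog H)) (i j : 'I_n) z :
  (i < j)%N -> tag z = tag (x i) + tag (x j) + 1 ->
  sg k (epsilon x i j + (i + j + 1)%N%:Z)
    * sg k (bs (z :: omit2 x i j ++ y) + bs [:: x i; x j]) =
  sg k (n%:Z + ((size y)%:Z * (degree (entries x) + 1) + bs y
                + bs (entries x)))
    * sg k (tag (x i) * before x i + tag (x j) * before x j
            - tag (x i) * tag (x j)).
Proof.
move=> ij zE; rewrite -!sgD /= zE bracket_sign_cat -(degree_omit2 _ ij).
rewrite -(bracket_sign_omit2 _ ij) /epsilon !shifted_beforeE size_cat.
have sE : (size (omit2 x i j))%:Z = n%:Z - 2.
  by rewrite -[n in RHS](size_omit2 x ij); lia.
apply: (@sg_mod2 k _ _ (tag (x i) * i%:Z + tag (x j) * j%:Z + i%:Z + j%:Z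
                        - tag (x j) - 1)).
rewrite !PoszD sE; ring.
Qed.

End BracketSign.

(** * The maps pi and beta *)

Section MapsOnHomology.
Variables (k : fieldType).

(** pi_* beta has degree [i - 1 + 2] and B has degree [i + 1]; these differ as
    expressions, so the classes can only be compared as homogeneous elements. *)
Lemma hom_hclass (X : complex k) i j (z : cycle X i) (w : cycle X j) :
  hom (\val z) = hom (\val w) ->
  hom (hclass z : homology X i) = hom (hclass w : homology X j).
Proof.
move=> e; have ij : i = j := congr1 (@tag _ _) e.
case: j / ij w e => w e; congr (hom (hclass _)).
by apply: val_inj; rewrite -(component_hom (\val z)) e component_hom.
Qed.

Variable C : mixedComplex k.

Lemma hom_mB i j j' (x : C i) : j = j' -> hom (mB C i j x) = hom (mB C i j' x).
Proof. by move=> ->. Qed.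

Lemma pi_beta x : hop (pi_star C) (hop (beta C) x) = hop (HHB C) x.
Proof.
case: x => i q; rewrite -[q]hreprK /hop /= /pi_star !hmap_class.
apply: hom_hclass => /=; rewrite /upi beta_chainE.
by apply: hom_mB; lia.
Qed.

(** A cycle of C[[u]] is itself a lift of its constant term, and b + u B kills
    it: the connecting homomorphism may be computed with this lift. *)
Lemma beta_pi i (q : HCm C i) : beta C i (pi_star C i q) = 0.
Proof.
rewrite -[q]hreprK; set x := hrepr q; rewrite [pi_star _ _ _]hmap_class.
rewrite (@beta_connecting k C i _ (\val x) 0) ?linear0 //.
have /eqP /= -> := valP x.
by apply: usP => -[|p].
Qed.

Lemma pi_Delta_closed x : Delta_closed (HHB C) (hop (pi_star C) x).
Proof.
by move=> e; rewrite -pi_beta /hop /= beta_pi linear0 component_hom0.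
Qed.

Lemma beta_HHB x e : component e (hop (beta C) (hop (HHB C) x)) = 0.
Proof. by rewrite -pi_beta /hop /= beta_pi component_hom0. Qed.

End MapsOnHomology.

(** * The gravity algebra structure *)

Section NegativeCyclicGravity.
Variables (k : fieldType) (C : mixedComplex k) (mul : gproduct (HH C)).
Hypothesis BV : is_BV mul (HHB C).
Local Notation H := (HCm C).
Local Notation m := (hmul mul).
Local Notation hprod := (hprod mul).
Local Notation pi := (hop (pi_star C)).
Local Notation beta := (hop (beta C)).
Local Notation D := (hop (HHB C)).
Local Notation br := (HCm_brackets mul).
Local Notation bs := (@bracket_sign k C).

Let mA := bv_mulA BV.
Let mC := bv_mulC BV.

Lemma bracket_cons a s :
  br (a :: s) = hscale (sg k (bs (a :: s))) (beta (hprod (pi a) (map pi s))).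
Proof. by []. Qed.

Lemma tag_bracket a s : tag (br (a :: s)) = tag a + degree s + 1.
Proof. by rewrite /= tag_hprod big_map -/(degree s) /=; lia. Qed.

Lemma bracket_bracket a s t :
  br (br (a :: s) :: t) =
  hscale (sg k (bs (br (a :: s) :: t) + bs (a :: s)))
    (beta (hprod (D (hprod (pi a) (map pi s))) (map pi t))).
Proof.
by rewrite bracket_cons bracket_cons hop_scale pi_beta hprod_scale hop_scale
  hscaleA -sgD.
Qed.

Lemma component_hprod s e : exists e' (T : {linear HH C e' -> HH C e}),
  forall u, component e (hprod u s) = T (component e' u).
Proof.
elim: s => [|z s [e' [T TE]]] /=; first by exists e, idfun.
exists (e' - tag z), (T \o hop_at (rmul mul z) e') => u.
by rewrite TE component_rmul.
Qed.

(** Linearity of u |-> beta(u s), in the form in which it can be applied to sums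
    of components. *)
Lemma component_beta_hprod s e : exists e' (T : {linear HH C e' -> H e}),
  forall u, component e (beta (hprod u s)) = T (component e' u).
Proof.
have [e' [T TE]] := component_hprod s (e - 1).
exists e', (hop_at (Defs.beta C) e \o T) => u /=.
by rewrite -TE; apply: component_hop => [i j|]; lia.
Qed.

Lemma bracket_deg (s : seq (homog H)) : (0 < size s)%N ->
  tag (br s) = \sum_(x <- s) tag x + 1.
Proof. by case: s => // a s _; rewrite tag_bracket big_cons. Qed.

Lemma bracket_linear (s t : seq (homog H)) i a (x y : H i) e :
  component e (br (s ++ hom (a *: x + y) :: t)) =
  a *: component e (br (s ++ hom x :: t)) + component e (br (s ++ hom y :: t)).
Proof.
have piP e' : component e' (pi (hom (a *: x + y)))
    = a *: component e' (pi (hom x)) + component e' (pi (hom y)).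
  by rewrite /hop /= linearP component_hom_is_linear.
have [e' [T TE]] := component_beta_hprod (map pi t) e.
have sE (v : H i) : bs (s ++ hom v :: t) = bs (s ++ hom (a *: x + y) :: t).
  by apply: bracket_sign_eq; rewrite !map_cat.
case: s sE => [|z s]; rewrite ?cat0s ?cat_cons => sE.
  rewrite !bracket_cons !sE !component_scale !TE piP linearP scalerDr !scalerA.
  by rewrite mulrC.
rewrite !bracket_cons !sE !component_scale !map_cat !hprod_cat !map_cons.
rewrite !hprod_mul !TE !component_lmul piP.
by rewrite !linearP.
Qed.

Lemma bracket_skew (s t : seq (homog H)) (x y : homog H) (e : int) :
  component e (br (s ++ x :: y :: t)) =
    - (sg k ((tag x + 1) * (tag y + 1)) *: component e (br (s ++ y :: x :: t))).
Proof.
have sE : sg k (bs (s ++ x :: y :: t)) * sg k (tag x * tag y) =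
    - sg k ((tag x + 1) * (tag y + 1)) * sg k (bs (s ++ y :: x :: t)).
  rewrite -mulN1r -[-1]/(sg k 1) -!sgD !bracket_sign_cat /=.
  by apply: (@sg_mod2 k _ _ (- 1 - tag y)); rewrite !intS; ring.
case: s sE => [|z s]; rewrite ?cat0s ?cat_cons => sE;
  rewrite !bracket_cons !component_scale -scaleNr scalerA -sE -scalerA;
  congr (_ *: _).
  by rewrite !hprod_mul (mC (pi x)) hprod_scale hop_scale component_scale.
rewrite !map_cat !map_cons !hprod_cat !hprod_mul -!mA (mC (pi x)) hmul_scaler.
by rewrite hprod_scale hop_scale component_scale.
Qed.

(** Both sides are the image of [Delta_hprod] under the linear map
    P |-> beta(P pi_*(y_1) ... pi_*(y_m)), up to one common sign; for
    m = 0 the right-hand one is beta B = 0. *)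
Lemma bracket_rel (n : nat) (x : 'I_n -> homog H) (y : seq (homog H)) e :
  (0 < n)%N ->
  \sum_(i < n) \sum_(j < n | (i < j)%N)
    sg k (epsilon x i j + (i + j + 1)%N%:Z) *:
      component e (br (br [:: x i; x j] :: omit2 x i j ++ y))
  = if (0 < size y)%N
    then sg k n%:Z *: component e (br (br (entries x) :: y))
    else 0.
Proof.
case: n x => // n x _; set N := n.+1.
(* The common sign of all terms, see [gravity_sign]. *)
pose c := sg k (N%:Z + ((size y)%:Z * (degree (entries x) + 1) + bs y
                        + bs (entries x))).
pose a i := pi (x i).
have aK i : Delta_closed (HHB C) (a i) by exact: pi_Delta_closed.
have mapa : map pi (entries (tail x)) = entries (tail a).
  by rewrite /entries -map_comp.
transitivity (c *: component e (beta (hprod (D (hprod (a ord0)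
    (entries (tail a)))) (map pi y)))); last first.
  case: y @c => [|y0 y] c; first by rewrite beta_HHB scaler0.
  rewrite [(0 < _)%N]/= entriesS bracket_bracket component_scale scalerA -sgD.
  rewrite mapa.
  congr (_ *: _); rewrite /c; congr (sg k _).
  rewrite -[bs (br _ :: y0 :: y)]/((size (y0 :: y))%:Z
    * tag (br (x ord0 :: entries (tail x))) + bs (y0 :: y)).
  by rewrite tag_bracket entriesS degree_cons; ring.
have [e' [T TE]] := component_beta_hprod (map pi y) e.
rewrite TE (Delta_hprod BV) // linear_sum scaler_sumr; apply: eq_bigr => i _.
rewrite linear_sum scaler_sumr; apply: eq_bigr => j ij.
have zE : tag (br [:: x i; x j]) = tag (x i) + tag (x j) + 1.
  by rewrite tag_bracket degree_cons /degree big_nil addr0.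
rewrite bracket_bracket component_scale scalerA (gravity_sign y ij zE) -scalerA.
congr (_ *: _); rewrite linearZ /= -TE map_cat hprod_cat.
by rewrite [map pi (omit2 x i j)](_ : _ = omit2 a i j) // /omit2 -map_comp.
Qed.

End NegativeCyclicGravity.

(** * Quasi-isomorphisms and power series *)

Section ChainMap.
Variables (k : fieldType) (X Y : complex k).
Variables (g : forall i, {linear X i -> Y i}) (gP : forall i, hcompat (g i)).

(** A pair (x, x') as in the hypotheses is a cycle of the mapping cone of [g], and
    (y, y') is a chain which it bounds.  The degrees i', j and l are kept as
    variables because the coefficients of power series have degrees that are
    equal to i - 1, i + 1 and i + 2 only up to a proof. *)
Definition cone_acyclic := forall i i' j l (x : X i) (x' : Y j),
  i' = i - 1 -> j = i + 1 -> l = j + 1 ->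
  cdiff X i i' x = 0 -> g i x = cdiff Y j i x' ->
  exists (y : X j) (y' : Y l), cdiff X j i y = x /\ g j y - x' = cdiff Y l j y'.

Hypothesis gC : forall i j (x : X i), g j (cdiff X i j x) = cdiff Y i j (g i x).

(** Injectivity makes [x] a boundary b y0; the cycle x' - g y0 is then corrected,
    by surjectivity, with the image of a cycle [z]; take y = y0 + z. *)
Lemma cone_acyclic_bij : (forall i, bijective (hmap (gP i))) -> cone_acyclic.
Proof.
move=> bij i i' j l x x' ei ej el dx gx; subst i' j l.
have x_cycle : x \in @is_cycle k X i by apply/eqP.
have : hmap (gP i) (hclass (Cycle x_cycle)) = hmap (gP i) (hclass 0).
  rewrite !hmap_class; apply/hclassP/asboolP; exists x'.
  by rewrite /= linear0 subr0.
move=> /(bij_inj (bij i))/hclassP/asboolP[y0 /=]; rewrite subr0 => xE.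
have w_cycle : x' - g (i + 1) y0 \in @is_cycle k Y (i + 1).
  apply/eqP; suff H n : n = i -> cdiff Y (i + 1) n (x' - g (i + 1) y0) = 0.
    by apply: H; rewrite addrK.
  by move=> ->; rewrite linearB -gC -xE gx subrr.
have [h _ hK] := bij (i + 1).
have := hK (hclass (Cycle w_cycle)); rewrite -[h _]hreprK.
set z := hrepr _; rewrite hmap_class => /hclassP/asboolP[y' /= y'E].
exists (y0 + \val z), y'; split; last first.
  by rewrite -y'E linearD opprB addrA (addrC (g _ y0)).
rewrite linearD -xE; suff -> : cdiff X (i + 1) i (\val z) = 0 by rewrite addr0.
suff H n : n = i + 1 - 1 -> cdiff X (i + 1) n (\val z) = 0.
  by apply: H; rewrite addrK.
by move=> ->; apply/eqP; exact: (valP z).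
Qed.

(** Injectivity is acyclicity applied to a cycle of X whose image bounds,
    surjectivity is acyclicity applied to a pair (0, x'). *)
Lemma bij_cone_acyclic : cone_acyclic -> forall i, bijective (hmap (gP i)).
Proof.
move=> acyclic i.
have inj : injective (hmap (gP i)).
  move=> p q pq; apply/eqP; rewrite -subr_eq0; apply/eqP.
  have pq0 : hmap (gP i) p - hmap (gP i) q = hclass 0.
    by rewrite pq subrr linear0.
  have := etrans (linearB (hmap (gP i)) p q) pq0.
  rewrite -[p - q]hreprK; set z := hrepr _.
  move=> /(etrans (esym (hmap_class (gP i) z)))/hclassP/asboolP[x' /=].
  rewrite subr0 => gz.
  have [|y [_ [yE _]]] := acyclic _ _ _ _ _ x' erefl erefl erefl _ gz.
    by apply/eqP; exact: (valP z).
  rewrite -[RHS](linear0 (@hclass k X i)); apply/hclassP/asboolP; exists y.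
  by rewrite yE subr0.
have surj q : exists p, hmap (gP i) p = q.
  rewrite -[q]hreprK; set w := hrepr q.
  have [||||y [y' [yE y'E]]] :=
    acyclic (i - 1) (i - 1 - 1) i (i + 1) 0 (\val w) erefl.
  - by rewrite subrK.
  - by [].
  - exact: linear0.
  - by rewrite linear0; symmetry; apply/eqP; exact: (valP w).
  have y_cycle : y \in @is_cycle k X i by apply/eqP.
  exists (hclass (Cycle y_cycle)); rewrite hmap_class.
  by apply/hclassP/asboolP; exists y'.
have [h hK] := choice surj.
by exists h => // q; apply: inj; rewrite hK.
Qed.

End ChainMap.

(** Commutative squares of chain-level maps induce commutative squares in
    homology; the naturality of pi_* and beta follows. *)
Lemma hmap_comp_eq (k : fieldType) (X Y Y' Z : complex k) i j j' l
    (f : {linear X i -> Y j}) (g : {linear Y j -> Z l})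
    (f' : {linear X i -> Y' j'}) (g' : {linear Y' j' -> Z l})
    (fP : hcompat f) (gP : hcompat g) (f'P : hcompat f') (g'P : hcompat g') q :
  (forall x, g (f x) = g' (f' x)) ->
  hmap gP (hmap fP q) = hmap g'P (hmap f'P q).
Proof.
move=> gf; rewrite -[q]hreprK !hmap_class; congr hclass.
by apply: val_inj => /=; rewrite gf.
Qed.

Lemma dependent_choice (T : nat -> Type) (inv : forall p, T p -> Prop)
    (R : forall p, T p -> T p.+1 -> Prop) (t0 : T 0%N) :
  inv 0%N t0 ->
  (forall p t, inv p t -> exists2 t', inv p.+1 t' & R p t t') ->
  exists2 s : forall p, T p, s 0%N = t0 & forall p, R p (s p) (s p.+1).
Proof.
move=> t0P step.
pose next p (t : {t : T p | inv p t}) := cid2 (step p _ (svalP t)).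
pose s : forall p, {t : T p | inv p t} := nat_rect _ (exist _ t0 t0P)
  (fun p t => exist _ (s2val (next p t)) (s2valP (next p t))).
by exists (fun p => sval (s p)) => // p; exact: (s2valP' (next p (s p))).
Qed.

Section SeriesMap.
Variables (k : fieldType) (C C' : mixedComplex k) (f : mixedMorphism C C').

Definition umap i (x : useries C i) : useries C' i :=
  fun p => f (udeg i p) (x p).

Fact umap_is_linear i : linear (@umap i).
Proof. by move=> a x y; apply: usP => p; exact: linearP. Qed.
HB.instance Definition _ i := GRing.isLinear.Build k (useries C i)
  (useries C' i) *:%R (@umap i) (@umap_is_linear i).

Lemma umap_udiff i j (x : useries C i) : umap (udiff j x) = udiff j (umap x).
Proof.
apply: usP => -[|p]; first exact: mmap_b.
by rewrite /umap /= linearD mmap_b mmap_B.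
Qed.

Fact umap_hcompat i : @hcompat k (ucomplex C) (ucomplex C') i i (@umap i).
Proof.
split=> [x /= dx|y]; first by rewrite -umap_udiff dx linear0.
by exists (umap y); exact: umap_udiff.
Qed.

Definition HCmap (i : int) : {linear HCm C i -> HCm C' i} :=
  hmap (umap_hcompat i).

Lemma HCmap_pi i q : pi_star C' i (HCmap i q) = HHmap f i (pi_star C i q).
Proof. exact: hmap_comp_eq. Qed.

Lemma HCmap_beta i q : HCmap (i - 1 + 2) (beta C i q) = beta C' i (HHmap f i q).
Proof.
apply: hmap_comp_eq => x; apply: usP => p.
rewrite [LHS]/(f _ (beta_chain x p)) beta_chainE.
apply: etrans (esym (beta_chainE (f i x) p)).
by case: p => [|p]; [exact: mmap_B | exact: linear0].
Qed.

(** The coefficients are found one after the other.  If y_p and y'_p are known,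
    y_(p+1) and y'_(p+1) must solve
      b y_(p+1) = x_(p+1) - B y_p,
      f y_(p+1) - (x'_(p+1) + B' y'_p) = b' y'_(p+1),
    which is possible by acyclicity for b once the right-hand data form a cycle
    of the cone. *)
Lemma umap_cone_acyclic :
  @cone_acyclic k (bcomplex C) (bcomplex C') f ->
  @cone_acyclic k (ucomplex C) (ucomplex C') umap.
Proof.
move=> acyclic i i' j l x x' ei ej el dx gx; rewrite /= in x x' dx gx *.
have xb p : mb C _ (udeg i' p.+1) (x p.+1) = - mB C _ (udeg i' p.+1) (x p).
  apply/eqP; rewrite -addr_eq0; apply/eqP.
  exact: (congr1 (fun s : useries C i' => s p.+1) dx).
pose T p := (C (udeg j p) * C' (udeg l p))%type.
(* This is what remains of the equations for y_p and y'_p after applying B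
   and B', which kill the terms with index p - 1; it suffices for the next
   step. *)
pose inv p (t : T p) :=
  mB C (udeg i p) (udeg i' p.+1) (mb C _ (udeg i p) t.1)
     = mB C (udeg i p) (udeg i' p.+1) (x p)
  /\ mB C' (udeg j p) (udeg i p.+1) (f _ t.1 - x' p)
     = mB C' (udeg j p) (udeg i p.+1) (mb C' _ (udeg j p) t.2).
pose R p (t : T p) (t' : T p.+1) :=
  mb C _ (udeg i p.+1) t'.1 = x p.+1 - mB C _ (udeg i p.+1) t.1 /\
  f _ t'.1 - (x' p.+1 + mB C' _ (udeg j p.+1) t.2) = mb C' _ (udeg j p.+1) t'.2.
have [y0 [y0' [y0E y0'E]]] : exists (y : C j) (y' : C' l),
    mb C j i y = x 0%N /\ f j y - x' 0%N = mb C' l j y'.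
  apply: acyclic ei ej el _ _.
    exact: (congr1 (fun s : useries C i' => s 0%N) dx).
  exact: (congr1 (fun s : useries C' i => s 0%N) gx).
have inv0 : inv 0%N (y0, y0') by rewrite /inv /= y0E y0'E.
have step p t : inv p t -> exists2 t', inv p.+1 t' & R p t t'.
  case: t => y y' [/= yE y'E].
  have [||||| z [z' [zE z'E]]] := acyclic (udeg i p.+1) (udeg i' p.+1)
    (udeg j p.+1) (udeg l p.+1) (x p.+1 - mB C _ (udeg i p.+1) y)
    (x' p.+1 + mB C' _ (udeg j p.+1) y').
  - by rewrite !udegE; lia.
  - by rewrite !udegE; lia.
  - by rewrite !udegE; lia.
  - rewrite linearB /= xb.
    rewrite -yE (@mBb' _ _ _ (udeg i p.+1)) ?opprK ?subrr // !udegE; lia.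
  - rewrite linearB linearD /= mmap_B.
    have -> : f _ (x p.+1) = mb C' _ (udeg i p.+1) (x' p.+1)
        + mB C' _ (udeg i p.+1) (x' p).
      exact: (congr1 (fun s : useries C' i => s p.+1) gx).
    rewrite -addrA -linearB -opprB linearN y'E; congr (_ + _).
    by rewrite (@mBb' _ _ _ (udeg j p.+1)) ?opprK // !udegE; lia.
  exists (z, z'); split=> //=.
    by rewrite zE linearB mB_sq subr0.
  move: z'E; rewrite opprD addrA => /(canRL (subrK _)) ->.
  by rewrite linearD mB_sq addr0.
have [s s0 sR] := dependent_choice inv0 step.
exists (fun p => (s p).1), (fun p => (s p).2); split; apply: usP => -[|p].
- by rewrite /= s0.
- by have [sE _] := sR p; rewrite /= sE subrK.
- by rewrite -[LHS]/(f _ (s 0%N).1 - x' 0%N) /= s0.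
have [_ sE] := sR p; rewrite /= -sE.
have subDK (U : zmodType) (u v w : U) : u - v = u - (v + w) + w.
  by rewrite opprD addrA subrK.
exact: subDK.
Qed.

End SeriesMap.

(** * Functoriality of the brackets *)

Section GravityIso.
Variables (k : fieldType) (C C' : mixedComplex k) (f : mixedMorphism C C').
Variables (mul : gproduct (HH C)) (mul' : gproduct (HH C')).

Lemma HCmap_bij : quasi_iso f -> forall i, bijective (HCmap f i).
Proof.
move=> fq; apply/bij_cone_acyclic/umap_cone_acyclic.
by apply: cone_acyclic_bij fq => i j x; exact: mmap_b.
Qed.

Hypothesis f_mul : forall i j x y,
  HHmap f (i + j) (mul i j x y) = mul' i j (HHmap f i x) (HHmap f j y).

Lemma hop_hprod a s :
  hop (HHmap f) (hprod mul a s) =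
  hprod mul' (hop (HHmap f) a) (map (hop (HHmap f)) s).
Proof.
elim: s a => //= b s IH a; rewrite IH; congr (hprod _ _ _).
by rewrite /hop /hmul /= f_mul.
Qed.

Lemma HCmap_brackets s : (0 < size s)%N ->
  hop (HCmap f) (HCm_brackets mul s) =
  HCm_brackets mul' (map (hop (HCmap f)) s).
Proof.
case: s => // a s _.
have natural x : hop (pi_star C') (hop (HCmap f) x)
    = hop (HHmap f) (hop (pi_star C) x).
  by rewrite /hop /= HCmap_pi.
rewrite map_cons !bracket_cons natural -map_comp (eq_map natural).
rewrite [X in hprod mul' _ X]map_comp -hop_hprod hop_scale.
rewrite {1 2}/hop /= HCmap_beta; congr (hscale (sg k _) _).
rewrite size_map (bracket_sign_eq (s' := map (hop (HCmap f)) s)) //.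
by rewrite -map_comp.
Qed.

End GravityIso.

Theorem theorem1p1 (R : realType) (k : fieldType) (iota : {rmorphism R -> k})
    (char0 : [pchar k] =i pred0) :
  (forall (C : mixedComplex k) (mul : gproduct (HH C)),
     is_BV mul (HHB C) -> is_gravity (HCm_brackets mul))
  /\
  (forall (C C' : mixedComplex k) (f : mixedMorphism C C')
      (mul : gproduct (HH C)) (mul' : gproduct (HH C')),
     quasi_iso f ->
     is_BV mul (HHB C) -> is_BV mul' (HHB C') ->
     BV_iso mul (HHB C) mul' (HHB C') (HHmap f) ->
     exists phi : forall i, {linear HCm C i -> HCm C' i},
       gravity_iso (HCm_brackets mul) (HCm_brackets mul') phi).
Proof.
split=> [C mul BV | C C' f mul mul' fq _ _ [_ f_mul _]].
  split.
  - by move=> s /ltnW; exact: bracket_deg.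
  - by move=> s t i a x y e _; exact: bracket_linear.
  - exact: bracket_skew BV.
  - by move=> n x y e /ltnW n0 _; exact: bracket_rel.
exists (HCmap f); split; first exact: HCmap_bij.
by move=> s /ltnW; exact: HCmap_brackets.
Qed.
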